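(* Let $\Bbbk$ be an algebraically closed field of characteristic zero, let $\lambda\in\Bbbk$ with $\lambda\neq0$, and let $\mathfrak U=\mathfrak U(\lambda)$ be the algebra presented in the context, with $\Omega=x^2g^{-1}-2\lambda(g^{-1}+g)$. For $\alpha,\beta\in\Bbbk$, define the left module $$M_\lambda(\alpha,\beta):=\mathfrak U/\mathfrak U(\Omega-\alpha,\ y+x-\beta g).$$ If $\alpha\neq\pm4\lambda$, then $M_\lambda(\alpha,\beta)$ is a simple $\mathfrak U$-module, and $\mathrm{ann}_{\mathfrak U}(M_\lambda(\alpha,\beta))=\langle\Omega-\alpha\rangle$.
   Context: $\mathfrak U(\lambda)$ is the associative unital $\Bbbk$-algebra generated by $g^{\pm1},x,y$ with relations $gg^{-1}=g^{-1}g=1$, $gxg^{-1}=x$, $gyg^{-1}=y+x$, $yx-xy=-\tfrac12x^2+\lambda(1-g^2)$. The element $\Omega$ is central. $\mathfrak U(a,b)=\mathfrak Ua+\mathfrak Ub$ denotes the left ideal generated by $a,b$; $\langle a\rangle$ denotes the two-sided ideal generated by $a$; $\mathrm{ann}_{\mathfrak U}(M)=\{r\in\mathfrak U\mid rm=0\ \text{for all } m\in M\}$. *)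

(* Defs.v *)
From HB Require Import structures.
From mathcomp Require Import all_boot all_algebra.
From mathcomp Require Import finmap monalg.
From mathcomp Require Import boolp classical_sets.

Set Implicit Arguments.
Unset Strict Implicit.
Unset Printing Implicit Defensive.

Import GRing.Theory.
Local Open Scope ring_scope.
Local Open Scope classical_set_scope.
Local Open Scope quotient_scope.

Definition two_sided_ideal (R : pzRingType) (I : set R) : Prop :=
  [/\ I 0,
      forall u v, I u -> I v -> I (u + v)
    & forall a u, I u -> I (a * u) /\ I (u * a)].

Definition ideal_generated_by (R : pzRingType) (G : set R) : set R :=
  smallest (@two_sided_ideal R) G.

Definition simple_module (R : pzRingType) (M : lmodType R) : Prop :=
  (exists m : M, m != 0) /\
  (forall N : set M, GRing.submod_closed [in N] -> N = [set 0] \/ N = setT).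

Definition annihilator (R : pzRingType) (M : lmodType R) : set R :=
  [set r | forall m : M, r *: m = 0].

Lemma two_sided_ideal_generated (R : pzRingType) (G : set R) :
  two_sided_ideal (ideal_generated_by G).
Proof.
split.
- by move=> I [[]].
- by move=> u v Iu Iv I IG; case: (IG) => -[_ ID _] _; apply: ID; [exact: Iu|exact: Iv].
- by move=> a u Iu; split=> I IG; case: (IG) => -[_ _ /(_ a u (Iu I IG)) []].
Qed.

Section QuotientModule.
Variables (R : pzRingType) (V : lmodType R) (S : submodClosed V).

Let S_zmod_closed : GRing.zmod_closed S := GRing.submod_closedB (submodClosedP S).

(* [submodClosed] does not inherit from [zmodClosed], which [Quotient.quot]
   expects. *)
Definition submod_zmodClosed : zmodClosed V :=
  HB.pack (GRing.SubmodClosed.sort S) (GRing.isZmodClosed.Build V (GRing.SubmodClosed.sort S) S_zmod_closed).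

Definition quot_module : Type := Quotient.quot submod_zmodClosed.
HB.instance Definition _ := GRing.Zmodule.on quot_module.
HB.instance Definition _ := EqQuotient.on quot_module.

Lemma quot_module_eqP (u v : V) :
  reflect (\pi_quot_module u = \pi_quot_module v) (u - v \in S).
Proof. by rewrite (Quotient.idealrBE submod_zmodClosed u v); exact: eqP. Qed.

Lemma quot_module_piD (u v : V) :
  \pi_quot_module (u + v) = \pi_quot_module u + \pi_quot_module v.
Proof. exact: (@pi_addr V _ 0 -%R +%R (Quotient.quot submod_zmodClosed)). Qed.

Definition quot_module_scale (a : R) : quot_module -> quot_module :=
  lift_op1 quot_module (fun u : V => a *: u).

Lemma quot_module_scale_pi a (u : V) :
  quot_module_scale a (\pi_quot_module u) = \pi_quot_module (a *: u).
Proof.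
unlock quot_module_scale; apply/quot_module_eqP; rewrite -scalerBr rpredZ //.
by apply/quot_module_eqP; rewrite reprK.
Qed.

Lemma quot_module_scaleA a b m :
  quot_module_scale a (quot_module_scale b m) = quot_module_scale (a * b) m.
Proof. by rewrite -[m]reprK !quot_module_scale_pi scalerA. Qed.

Lemma quot_module_scale1 : left_id 1 quot_module_scale.
Proof. by move=> m; rewrite -[m]reprK !quot_module_scale_pi scale1r. Qed.

Lemma quot_module_scaleDr : right_distributive quot_module_scale +%R.
Proof.
move=> a m n; rewrite -[m]reprK -[n]reprK.
by rewrite -quot_module_piD !quot_module_scale_pi -quot_module_piD scalerDr.
Qed.

Lemma quot_module_scaleDl m : {morph quot_module_scale^~ m : a b / a + b}.
Proof.
move=> a b; rewrite -[m]reprK.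
by rewrite !quot_module_scale_pi -quot_module_piD scalerDl.
Qed.

HB.instance Definition _ := GRing.Zmodule_isLmodule.Build R quot_module
  quot_module_scaleA quot_module_scale1 quot_module_scaleDr quot_module_scaleDl.

Lemma quot_module_piZ a (u : V) :
  \pi_quot_module (a *: u) = a *: \pi_quot_module u.
Proof. by rewrite -quot_module_scale_pi. Qed.

End QuotientModule.

Section LeftIdeal.
Variables (R : nzRingType) (a b : R).

(* [R a + R b], seen as a submodule of the left regular module [R^o]. *)
Definition left_ideal2 : {pred R^o} :=
  fun r => `[< exists u v : R, r = u * a + v * b >].

Lemma left_ideal2_submod_closed : GRing.subsemimod_closed left_ideal2.
Proof.
split; first split.
- by apply/asboolP; exists 0, 0; rewrite !mul0r addr0.
- move=> r s /asboolP[u [v ->]] /asboolP[u' [v' ->]].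
  by apply/asboolP; exists (u + u'), (v + v'); rewrite !mulrDl addrACA.
- move=> c r /asboolP[u [v ->]]; apply/asboolP; exists (c * u), (c * v).
  by rewrite -!mulrA -mulrDr.
Qed.

HB.instance Definition _ :=
  GRing.isSubmodClosed.Build R R^o left_ideal2 left_ideal2_submod_closed.

End LeftIdeal.

Section QuotientAlgebra.
Variables (K : comNzRingType) (A : algType K) (G : set A).

Definition relation_ideal : {pred A} := fun r => `[< ideal_generated_by G r >].

Lemma relation_idealMl a r : relation_ideal r -> relation_ideal (a * r).
Proof.
have [_ _ IM] := two_sided_ideal_generated G.
by move=> /asboolP Ir; apply/asboolP; have [] := IM a r Ir.
Qed.

Lemma relation_idealMr a r : relation_ideal r -> relation_ideal (r * a).
Proof.
have [_ _ IM] := two_sided_ideal_generated G.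
by move=> /asboolP Ir; apply/asboolP; have [] := IM a r Ir.
Qed.

Lemma relation_ideal_submod_closed : GRing.subsemimod_closed relation_ideal.
Proof.
have [I0 ID _] := two_sided_ideal_generated G.
split; first split.
- exact/asboolP.
- by move=> r s /asboolP Ir /asboolP Is; apply/asboolP; exact: ID.
- by move=> c r Ir; rewrite -[r]mul1r scalerAl; exact: relation_idealMl.
Qed.

HB.instance Definition _ :=
  GRing.isSubmodClosed.Build K A relation_ideal relation_ideal_submod_closed.

Definition quot_algebra : Type := quot_module relation_ideal.
HB.instance Definition _ := GRing.Lmodule.on quot_algebra.
HB.instance Definition _ := EqQuotient.on quot_algebra.

Definition quot_one : quot_algebra := \pi_quot_algebra 1.
Definition quot_mul : quot_algebra -> quot_algebra -> quot_algebra :=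
  lift_op2 quot_algebra (fun r s : A => r * s).

Lemma quot_mul_pi (r s : A) :
  quot_mul (\pi_quot_algebra r) (\pi_quot_algebra s) = \pi_quot_algebra (r * s).
Proof.
have piU (t : A) : t - repr (\pi_quot_algebra t) \in (relation_ideal : pred _).
  by apply/(quot_module_eqP relation_ideal); rewrite reprK.
unlock quot_mul; apply/esym/(quot_module_eqP relation_ideal).
rewrite -[r * s](subrK (repr (\pi_quot_algebra r) * s)) -mulrBl -addrA -mulrBr.
by rewrite rpredD //;
  [exact: (relation_idealMr _ (piU r))|exact: (relation_idealMl _ (piU s))].
Qed.

Lemma quot_mulA : associative quot_mul.
Proof.
move=> a b c; rewrite -[a]reprK -[b]reprK -[c]reprK.
by rewrite !quot_mul_pi mulrA.
Qed.

Lemma quot_mul1l : left_id quot_one quot_mul.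
Proof. by move=> a; rewrite -[a]reprK quot_mul_pi mul1r. Qed.

Lemma quot_mul1r : right_id quot_one quot_mul.
Proof. by move=> a; rewrite -[a]reprK quot_mul_pi mulr1. Qed.

Lemma quot_mulDl : left_distributive quot_mul +%R.
Proof.
move=> a b c; rewrite -[a]reprK -[b]reprK -[c]reprK.
by rewrite -quot_module_piD !quot_mul_pi mulrDl quot_module_piD.
Qed.

Lemma quot_mulDr : right_distributive quot_mul +%R.
Proof.
move=> a b c; rewrite -[a]reprK -[b]reprK -[c]reprK.
by rewrite -quot_module_piD !quot_mul_pi mulrDr quot_module_piD.
Qed.

HB.instance Definition _ := GRing.Zmodule_isPzRing.Build quot_algebra
  quot_mulA quot_mul1l quot_mul1r quot_mulDl quot_mulDr.

Lemma quot_algebra_pi1 : \pi_quot_algebra 1 = 1.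
Proof. by []. Qed.

Lemma quot_algebra_piM (r s : A) :
  \pi_quot_algebra (r * s) = \pi_quot_algebra r * \pi_quot_algebra s.
Proof. exact/esym/quot_mul_pi. Qed.

Lemma quot_algebra_scaleAl (c : K) (a b : quot_algebra) :
  c *: (a * b) = (c *: a) * b.
Proof.
rewrite -[a]reprK -[b]reprK -quot_module_piZ -!quot_algebra_piM.
by rewrite -quot_module_piZ scalerAl.
Qed.

Lemma quot_algebra_scaleAr (c : K) (a b : quot_algebra) :
  c *: (a * b) = a * (c *: b).
Proof.
rewrite -[a]reprK -[b]reprK -quot_module_piZ -!quot_algebra_piM.
by rewrite -quot_module_piZ scalerAr.
Qed.

End QuotientAlgebra.

Lemma malg_scaleAr (K : comNzRingType) (T : monomType) (c : K)
  (r s : {malg K[T]}) : c *: (r * s) = r * (c *: s).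
Proof.
apply/malgP=> m.
have supp_r : (msupp r `<=` msupp r)%fset by exact: fsubset_refl.
rewrite mcoeffZ mcoeffMl (mcoeffMlw m supp_r (msuppZ_le c s)).
rewrite mulr_sumr; apply: eq_bigr => i _.
rewrite mulr_sumr; apply: eq_bigr => j _.
by rewrite mcoeffZ mulrnAr mulrCA.
Qed.

(* The free associative algebra on [X] is the monoid algebra of the free monoid
   on [X]. *)
Section FreeAlgebra.
Variables (K : comNzRingType) (X : choiceType).

Definition free_algebra : Type := {malg K[{fmonom X}]}.
HB.instance Definition _ := GRing.Lalgebra.on free_algebra.
HB.instance Definition _ :=
  GRing.Lalgebra_isAlgebra.Build K free_algebra (@malg_scaleAr K {fmonom X}).

Definition free_gen (s : X) : free_algebra := << fmu s >>.

Section Character.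
Variable h : X -> K.

Definition free_char_monom (m : {fmonom X}) : K := \prod_(s <- m) h s.

Lemma free_char_monom_morphism : mmorphism free_char_monom.
Proof.
split; first by move=> m n; rewrite /free_char_monom fmM big_cat.
by rewrite /free_char_monom fm1 big_nil.
Qed.

HB.instance Definition _ :=
  isMultiplicative.Build _ _ free_char_monom free_char_monom_morphism.

Definition free_char (r : free_algebra) : K := mmap idfun free_char_monom r.

Lemma free_char_gen s : free_char (free_gen s) = h s.
Proof. by rewrite /free_char mmapU /free_char_monom fmU big_seq1 mul1r. Qed.

Lemma free_char0 : free_char 0 = 0.
Proof. exact: mmap0. Qed.

Lemma free_char1 : free_char 1 = 1.
Proof. exact: mmap1. Qed.

Lemma free_charD : {morph free_char : r s / r + s}.
Proof. exact: mmapD. Qed.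

Lemma free_charN : {morph free_char : r / - r}.
Proof. exact: mmapN. Qed.

Lemma free_charM : {morph free_char : r s / r * s}.
Proof. exact: (rmorphM (mmap idfun free_char_monom)). Qed.

Lemma free_charZ c r : free_char (c *: r) = c * free_char r.
Proof. exact: mmapZ. Qed.

End Character.
End FreeAlgebra.

Inductive generator := Gen_g | Gen_ginv | Gen_x | Gen_y.

Definition nat_of_generator (s : generator) : nat :=
  match s with Gen_g => 0 | Gen_ginv => 1 | Gen_x => 2 | Gen_y => 3 end.

Definition generator_of_nat (n : nat) : generator :=
  match n with 0 => Gen_g | 1 => Gen_ginv | 2 => Gen_x | _ => Gen_y end.

Lemma nat_of_generatorK : cancel nat_of_generator generator_of_nat.
Proof. by case. Qed.

HB.instance Definition _ := Countable.copy generator (can_type nat_of_generatorK).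

Section U.
Variables (k : fieldType) (lambda : k).

(* Differences of the two sides of the defining relations. *)
Definition U_relators : set (free_algebra k generator) :=
  let g := free_gen k Gen_g in let ginv := free_gen k Gen_ginv in
  let x := free_gen k Gen_x in let y := free_gen k Gen_y in
  [set g * ginv - 1;
       ginv * g - 1;
       g * x * ginv - x;
       g * y * ginv - (y + x);
       (y * x - x * y) - (- (2^-1 *: x ^+ 2) + lambda *: (1 - g ^+ 2))].

Definition U : Type := quot_algebra U_relators.
HB.instance Definition _ := GRing.PzRing.on U.
HB.instance Definition _ := GRing.Lmodule.on U.
HB.instance Definition _ := EqQuotient.on U.

(* The character [g, g^-1 |-> 1], [x, y |-> 0] respects the relations, hence
   the algebra is not trivial. *)
Definition U_counit : free_algebra k generator -> k :=
  free_char (fun s => if s is (Gen_g | Gen_ginv) then 1 else 0).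

Lemma U_counit_relators r : ideal_generated_by U_relators r -> U_counit r = 0.
Proof.
rewrite /U_counit; apply: (smallest_sub (X := [set r | free_char _ r = 0])) => /=.
  split=> [|u v /= u0 v0|a u /= u0].
  - exact: free_char0.
  - by rewrite free_charD u0 v0 addr0.
  - by rewrite !free_charM u0 mulr0 mul0r.
by move=> t [[[[]|]|]|] -> /=; rewrite ?expr2
   !(free_charD, free_charN, free_charM, free_charZ, free_char1, free_char_gen)
   ?(mulr0, mul0r, mulr1, subrr, addr0, oppr0).
Qed.

Lemma U_oner_neq0 : (1 : U) != 0.
Proof.
rewrite -(scale0r (1 : U)) -quot_module_piZ scale0r.
apply/eqP => /(quot_module_eqP (relation_ideal U_relators)).
rewrite subr0 => /asboolP/U_counit_relators/eqP.
by rewrite /U_counit free_char1 oner_eq0.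
Qed.

HB.instance Definition _ := GRing.PzSemiRing_isNonZero.Build U U_oner_neq0.
HB.instance Definition _ :=
  GRing.Lmodule_isLalgebra.Build k U (@quot_algebra_scaleAl _ _ U_relators).
HB.instance Definition _ :=
  GRing.Lalgebra_isAlgebra.Build k U (@quot_algebra_scaleAr _ _ U_relators).

Definition U_gen (s : generator) : U := \pi_U (free_gen k s).

Definition Omega : U :=
  let g := U_gen Gen_g in let ginv := U_gen Gen_ginv in let x := U_gen Gen_x in
  x ^+ 2 * ginv - (2 * lambda) *: (ginv + g).

Definition M (alpha beta : k) : Type :=
  let g := U_gen Gen_g in let x := U_gen Gen_x in let y := U_gen Gen_y in
  quot_module (left_ideal2 (Omega - alpha%:A) (y + x - beta *: g)).
HB.instance Definition _ alpha beta := GRing.Lmodule.on (M alpha beta).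

End U.

(* Main.v *)
From HB Require Import structures.
Require Import Defs.
From mathcomp Require Import all_boot all_algebra ring.
From mathcomp Require Import finmap monalg.
From mathcomp Require Import boolp classical_sets functions.

(** In U(lambda) the elements g, g^-1 and x commute, and the commutator with y
is a derivation D of the subalgebra that they generate, given by D(g) = - x g
and D(x) = - x^2 / 2 + lambda (1 - g^2).  The element Omega is central, and
Omega = alpha amounts to x^2 = h(g) with
h = 2 lambda + alpha g + 2 lambda g^2.  So U / <Omega - alpha> is spanned over
B = k[g, g^-1, x] / (x^2 - h(g)) by the powers of y, with y f = f y + D(f), and
M_lambda(alpha, beta) is B itself, on which y acts as D + (beta g - x).

The discriminant identity h'^2 - 8 lambda h = alpha^2 - 16 lambda^2 turns the
hypothesis on alpha into the statement that h has simple roots: the curve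
x^2 = h(g) is smooth, and D, read as a vector field, is tangent to it and
vanishes nowhere.  In characteristic zero such a derivation stabilises no ideal
of B besides 0 and B.

Submodules of M_lambda(alpha, beta) are the D-stable ideals of B, hence
simplicity.  The lemma [stable_eval_mem] contains the argument: the norm of a
nonzero element of a stable ideal is a nonzero polynomial in g, and
[stable_poly_ideal] shows that a nonzero polynomial of least degree in a stable
ideal is constant, because the derivatives produced by y lower the multiplicity
of each of its roots.

The annihilator is a two-sided ideal that contains Omega - alpha but not 1.
The quotient U / <Omega - alpha> is a simple ring: commutators with x and g lower
the degree in y, and since D vanishes nowhere, a combination of the two keeps
the leading coefficient up to a unit ([filt_two_sided_ideal]).

Both arguments need M_lambda(alpha, beta) to be nonzero.  This is read off from
an explicit action of U(lambda) on formal series a(g) + b(g) x that are infinite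
in both directions, where the series 1 satisfies the relations defining the
module ([oner_notin_left_ideal2]). *)

Set Implicit Arguments.
Unset Strict Implicit.
Unset Printing Implicit Defensive.

Import GRing.Theory.
Local Open Scope ring_scope.
Local Open Scope classical_set_scope.
Local Open Scope quotient_scope.

(** * Polynomials stable under the derivation *)
Local Definition horner_ringE :=
  (hornerD, hornerN, hornerM, hornerC, hornerX, horner_exp, hornerZ).

Lemma natrS_neq0 (k : fieldType) (char0 : [pchar k] =i pred0) (n : nat) :
  n.+1%:R != 0 :> k.
Proof. by rewrite (pcharf0P k).1. Qed.

(** Multiplicities decide.  Let r be a root of p of multiplicity m > 0.  The
first divisibility forces h(r) = 0.  As the root r of h is simple, the
expansion of h' p' + 2 h p'' at r starts with a nonzero multiple of
m (2 m - 1) (X - r)^(m - 1), so that p cannot divide it in characteristic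
zero. *)
Lemma invariant_poly_constant (k : closedFieldType)
    (char0 : [pchar k] =i pred0) (h p : {poly k}) :
  (forall r, root h r -> h^`().[r] != 0) -> p != 0 -> p %| h * p^`() ->
  p %| h^`() * p^`() + 2 *: (h * p^`()^`()) -> size p = 1%N.
Proof.
move=> hs p0 d1 d2; apply/eqP/negPn/negP => /closed_rootP[r pr].
have [m [q]] := multiplicity_XsubC p r; rewrite p0 /= => qr.
case: m => [|m] Dp; first by rewrite Dp expr0 mulr1 (negPf qr) in pr.
have [t Dt] : exists t, t = 'X - r%:P by eexists.
rewrite -Dt in Dp; rewrite rootE in qr.
have t0 : t != 0 by rewrite Dt polyXsubC_eq0.
have dt : t^`() = 1 by rewrite Dt derivB derivX derivC subr0.
have Dp' : p^`() = t ^+ m * (m.+1%:R%:P * q + t * q^`()).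
  by rewrite Dp derivM deriv_exp dt mul1r /= exprS -mulr_natl polyC_natr; ring.
have /dvdpP[l Dl] := d1.
have tr : t.[r] = 0 by rewrite Dt !horner_ringE subrr.
have E1 : h * (m.+1%:R%:P * q + t * q^`()) = l * t * q.
  apply: (mulfI (expf_neq0 m t0)); rewrite mulrCA -Dp' Dl Dp exprS; ring.
have hr : root h r.
  have := congr1 (horner^~ r) E1; rewrite !horner_ringE tr mulr0 mul0r mul0r addr0.
  move/eqP; rewrite !mulf_eq0 (negPf qr) orbF => /orP[//|].
  by rewrite (negPf (natrS_neq0 char0 m)).
have /factor_theorem[h1 Dh] := hr; rewrite -Dt in Dh.
have h1r : h^`().[r] = h1.[r].
  by rewrite Dh derivM dt !horner_ringE tr; ring.
have h1r0 := hs r hr; rewrite h1r in h1r0.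
have E2 : h1 * (m.+1%:R%:P * q + t * q^`()) = l * q.
  by apply: (mulfI t0); rewrite mulrA [t * h1]mulrC -Dh E1; ring.
have lr : l.[r] = m.+1%:R * h1.[r].
  have := congr1 (horner^~ r) E2; rewrite !horner_ringE tr mul0r addr0.
  by rewrite mulrA => /(mulIf qr) <-; ring.
(* The derivative of h p' = l p expresses h p'' through p and p'. *)
have /dvdpP[l2 Dl2] : p %| (2%:P * l - h^`()) * p^`().
  have -> : (2%:P * l - h^`()) * p^`() =
      (h^`() * p^`() + 2 *: (h * p^`()^`())) - 2%:P * l^`() * p.
    have := congr1 deriv Dl; rewrite !derivM => D.
    rewrite -mul_polyC -[h * _](addKr (h^`() * p^`())) D; ring.
  by rewrite dvdp_sub // dvdp_mull.
have E3 : (2%:P * l - h^`()) * (m.+1%:R%:P * q + t * q^`()) = l2 * t * q.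
  apply: (mulfI (expf_neq0 m t0)); rewrite mulrCA -Dp' Dl2 Dp exprS; ring.
have := congr1 (horner^~ r) E3; rewrite !horner_ringE tr lr h1r.
rewrite mulr0 !mul0r addr0 => /eqP.
rewrite !mulf_eq0 (negPf qr) (negPf (natrS_neq0 char0 m)) !orbF.
have -> : 2 * (m.+1%:R * h1.[r]) - h1.[r] = (m.*2.+1)%:R * h1.[r].
  by rewrite -addnn -(addn1 m) -(addn1 (m + m)) !natrD; ring.
by rewrite mulf_eq0 (negPf h1r0) orbF (negPf (natrS_neq0 char0 _)).
Qed.

(** * The curve x^2 = h(g) *)
Section Conic.
Variables (k : fieldType) (lambda alpha : k).

(** The equation Omega = alpha, multiplied by g, reads x^2 = h(g) with this h. *)
Definition conic : {poly k} :=
  (2 * lambda)%:P + alpha *: 'X + (2 * lambda) *: 'X^2.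

Lemma deriv_conic : conic^`() = alpha%:P + (4 * lambda) *: 'X.
Proof.
rewrite /conic !derivE -!mul_polyC !rmorphM !rmorph_nat /=; ring.
Qed.

Lemma conic_polyC : conic%:P =
  2 * lambda%:P%:P + alpha%:P%:P * 'X%:P + 2 * lambda%:P%:P * 'X%:P ^+ 2.
Proof. by rewrite /conic -!mul_polyC !polyCD !polyCM expr2 !polyC_natr. Qed.

Lemma deriv_conic_polyC : (conic^`())%:P = alpha%:P%:P + 4 * lambda%:P%:P * 'X%:P.
Proof. by rewrite deriv_conic -!mul_polyC !polyCD !polyCM !polyC_natr. Qed.

(** Since h'^2 - 8 lambda h is a constant, h and h' have no common root unless
it vanishes, that is, unless alpha is 4 lambda or - 4 lambda. *)
Lemma conic_discriminant :
  conic^`() ^+ 2 - (8 * lambda) *: conic = (alpha ^+ 2 - 16 * lambda ^+ 2)%:P.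
Proof.
rewrite deriv_conic /conic -!mul_polyC.
rewrite !(polyCM, rmorphB, rmorphM, rmorphXn, rmorph_nat) /=; ring.
Qed.

End Conic.

Section ClosedConic.
Variables (k : closedFieldType) (char0 : [pchar k] =i pred0) (lambda alpha : k).
Hypothesis lambda_neq0 : lambda != 0.
Local Notation conic := (conic lambda alpha).

Lemma size_conic : size conic = 3.
Proof.
rewrite /conic addrC size_polyDl ?size_scale ?size_polyXn ?mulf_neq0
  ?(natrS_neq0 char0 1) //.
rewrite (leq_ltn_trans (size_polyD _ _)) // gtn_max.
by rewrite (leq_ltn_trans (size_polyC_leq1 _)) //
  (leq_ltn_trans (size_scale_leq _ _)) // size_polyX.
Qed.

Lemma conic_neq0 : conic != 0.
Proof. by rewrite -size_poly_eq0 size_conic. Qed.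

Hypothesis disc_neq0 : alpha ^+ 2 - 16 * lambda ^+ 2 != 0.

Lemma conic_simple_root r : root conic r -> conic^`().[r] != 0.
Proof.
move=> /rootP hr; apply: contra disc_neq0 => /eqP hr'.
have := congr1 (horner^~ r) (conic_discriminant lambda alpha).
by rewrite hornerD hornerN hornerZ horner_exp hornerC hr hr' => <-;
  rewrite expr0n mulr0 subr0.
Qed.

Lemma mup_conic : exists r, mup r conic = 1%N.
Proof.
have [r hr] : exists r, root conic r by apply/closed_rootP; rewrite size_conic.
exists r; apply/eqP; rewrite eqn_leq mup_geq ?mup_leq ?conic_neq0 //.
rewrite expr1 dvdp_XsubCl hr andbT.
apply/negP => /dvdpP[q Dq]; case/negP: (conic_simple_root hr).
rewrite Dq expr2 !derivM derivB derivX derivC !horner_ringE; apply/eqP; ring.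
Qed.

(** The square root x of h is not a rational function of g: a simple root of h
has even multiplicity in a^2 and odd multiplicity in b^2 h. *)
Lemma conic_norm_eq0 (a b : {poly k}) : a ^+ 2 = b ^+ 2 * conic -> a = 0 /\ b = 0.
Proof.
move=> ab; have [b0|b0] := eqVneq b 0.
  by move/eqP: ab; rewrite b0 expr0n mul0r expf_eq0 => /eqP.
have a0 : a != 0.
  have : a ^+ 2 != 0 by rewrite ab mulf_neq0 ?expf_neq0 ?conic_neq0.
  by rewrite expf_eq0.
have [r hr] := mup_conic; have := congr1 (mup r) ab.
rewrite !expr2 !mupM ?mulf_neq0 ?conic_neq0 // hr !addnn => /(congr1 odd).
by rewrite addn1 /= !odd_double.
Qed.

End ClosedConic.

Lemma quadratic_division (R : comNzRingType) (h : R) (P : {poly R}) :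
  exists Q a b, P = Q * ('X^2 - h%:P) + (a%:P + b%:P * 'X).
Proof.
elim/poly_ind: P => [|P c [Q [a [b ->]]]].
  by exists 0, 0, 0; rewrite !mul0r !addr0.
by exists (Q * 'X + b%:P), (c + b * h), a; rewrite polyCD polyCM; ring.
Qed.

(** * The derivation [y, -] and the centrality of Omega *)
Definition left_ideal (R : pzRingType) (L : set R) : Prop :=
  [/\ L 0, forall u v, L u -> L v -> L (u + v) & forall a u, L u -> L (a * u)].

(** The algebra is kept abstract, so that only the relations and, for some
results, generation by g, gi = g^-1, x, y matter; [om] is Omega - alpha. *)
Section JordanAlgebra.
Variables (k : closedFieldType) (char0 : [pchar k] =i pred0) (lambda alpha : k).
Hypothesis lambda_neq0 : lambda != 0.
Hypothesis disc_neq0 : alpha ^+ 2 - 16 * lambda ^+ 2 != 0.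
Variables (A : algType k) (g gi x y : A).
Hypothesis ggi : g * gi = 1.
Hypothesis gig : gi * g = 1.
Hypothesis conj_x : g * x * gi = x.
Hypothesis conj_y : g * y * gi = y + x.
Hypothesis commutator_yx :
  y * x - x * y = - (2^-1 *: x ^+ 2) + lambda *: (1 - g ^+ 2).

Let h : {poly k} := conic lambda alpha.
Let om : A := x ^+ 2 * gi - (2 * lambda) *: (gi + g) - alpha%:A.

Definition ad (c : A) : A := y * c - c * y.

Lemma adD : {morph ad : a b / a + b}.
Proof. by move=> a b; rewrite /ad mulrDr mulrDl opprD addrACA. Qed.

Lemma adM a b : ad (a * b) = ad a * b + a * ad b.
Proof. by rewrite /ad mulrBl mulrBr !mulrA addrA subrK. Qed.

Lemma adZ c a : ad (c *: a) = c *: ad a.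
Proof. by rewrite /ad -scalerAl -scalerAr scalerBr. Qed.

Lemma ad_alg c : ad c%:A = 0.
Proof. by rewrite adZ /ad mulr1 mul1r subrr scaler0. Qed.

Lemma comm_gx : g * x = x * g.
Proof. by rewrite -{2}conj_x -!mulrA gig mulr1. Qed.

Lemma ad_g : ad g = - (x * g).
Proof.
have gy : g * y = (y + x) * g by rewrite -conj_y -mulrA gig mulr1.
by rewrite /ad gy mulrDl opprD addNKr.
Qed.

Lemma comm_gix : gi * x = x * gi.
Proof. by rewrite -[LHS]mulr1 -ggi mulrA -(mulrA gi) -comm_gx mulrA gig mul1r. Qed.

Lemma comm_horner_alg_x : commr_rmorph (horner_alg g) x.
Proof.
move=> p; elim/poly_ind: p => [|p c IH]; first by rewrite rmorph0; exact: commr0.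
rewrite rmorphD rmorphM /= horner_algX horner_algC.
apply: commrD; last by rewrite /GRing.comm comm_alg.
by apply: commrM => //; rewrite /GRing.comm comm_gx.
Qed.

(** The commutative subalgebra k[g, x], with the outer variable sent to x and the
inner one to g.  Negative powers of g are left out: as g is a unit, they can
always be cleared by a multiplication on the left. *)
Definition eval_gx : {poly {poly k}} -> A := horner_morph comm_horner_alg_x.
HB.instance Definition _ := GRing.RMorphism.on eval_gx.

Lemma eval_gxX : eval_gx 'X = x.
Proof. exact: horner_morphX. Qed.

Lemma eval_gxC p : eval_gx p%:P = horner_alg g p.
Proof. exact: horner_morphC. Qed.

Lemma eval_gxCX : eval_gx ('X)%:P = g.
Proof. by rewrite eval_gxC horner_algX. Qed.

Lemma eval_gxCC c : eval_gx c%:P%:P = c%:A.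
Proof. by rewrite eval_gxC horner_algC. Qed.

Definition vfield_x : {poly {poly k}} :=
  - (2^-1)%:P%:P * 'X^2 + lambda%:P%:P * (1 - 'X%:P ^+ 2).

(** The derivation of k[g, x] induced by [ad]: the derivative with respect to x
times [y, x], plus the derivative with respect to g times [y, g] = - x g. *)
Definition vfield (P : {poly {poly k}}) : {poly {poly k}} :=
  vfield_x * P^`() - 'X * 'X%:P * map_poly deriv P.

Lemma half_polyC : 2 * (2^-1)%:P%:P = 1 :> {poly {poly k}}.
Proof. by rewrite -!polyC_natr -!polyCM mulfV ?(natrS_neq0 char0). Qed.

Lemma ad_x : ad x = eval_gx vfield_x.
Proof.
rewrite /ad commutator_yx /vfield_x !(rmorphD, rmorphN, rmorphM, rmorph1, rmorphXn) /=.
by rewrite eval_gxX eval_gxCX !eval_gxCC mulNr !mulr_algl.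
Qed.

Lemma ad_horner p : ad (horner_alg g p) = eval_gx (vfield p%:P).
Proof.
rewrite /vfield derivC mulr0 sub0r map_polyC /=.
elim/poly_ind: p => [|p c IH].
  by rewrite deriv0 !rmorph0 mulr0 oppr0 rmorph0 /ad mulr0 mul0r subrr.
rewrite rmorphD rmorphM /= horner_algX horner_algC adD adM ad_alg addr0 IH ad_g.
transitivity (eval_gx (- ('X * 'X%:P * (p^`())%:P) * 'X%:P - p%:P * ('X * 'X%:P))).
  by rewrite rmorphB !rmorphM /= eval_gxX eval_gxCX eval_gxC mulrN.
congr eval_gx.
rewrite derivD derivM derivX derivC addr0 mulr1 polyCD polyCM; ring.
Qed.

Lemma map_deriv_mulX (P : {poly {poly k}}) :
  map_poly deriv (P * 'X) = map_poly deriv P * 'X.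
Proof.
apply/polyP => i; rewrite coef_map_id0 ?raddf0 // !coefMX.
by case: i => [|i]; rewrite ?raddf0 //= coef_map_id0 ?raddf0.
Qed.

Lemma map_derivX : map_poly deriv 'X = 0 :> {poly {poly k}}.
Proof. by rewrite -['X]mul1r map_deriv_mulX -polyC1 map_polyC /= derivC mul0r. Qed.

Lemma map_deriv_MXaddC (P : {poly {poly k}}) p :
  map_poly deriv (P * 'X + p%:P) = map_poly deriv P * 'X + (p^`())%:P.
Proof. by rewrite -map_deriv_mulX -map_polyC -raddfD. Qed.

Lemma ad_eval_gx P : ad (eval_gx P) = eval_gx (vfield P).
Proof.
elim/poly_ind: P => [|P p IH].
  by rewrite /vfield deriv0 !raddf0 !mulr0 subrr raddf0 /ad mulr0 mul0r subrr.
rewrite rmorphD rmorphM /= eval_gxX adD adM IH ad_x eval_gxC ad_horner -eval_gxX.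
rewrite -!rmorphM -!rmorphD; congr eval_gx.
rewrite /vfield map_deriv_MXaddC map_polyC !derivD !derivM derivC derivX addr0 mulr1 /=.
ring.
Qed.

Lemma g_om : g * om = eval_gx ('X^2 - h%:P).
Proof.
rewrite /om /h /conic; move: (2 * lambda) => c.
rewrite rmorphB rmorphXn /= eval_gxX eval_gxC -!mul_polyC !rmorphD !rmorphM /=.
rewrite horner_algX !horner_algC !mulr_algl !mulrBr (mulrA g (x ^+ 2)).
have -> : g * x ^+ 2 * gi = x ^+ 2.
  by rewrite expr2 mulrA comm_gx -(mulrA x) comm_gx -!mulrA ggi mulr1.
rewrite -!scalerAr mulrDr ggi mulr1 scalerDr.
by rewrite -addrA -opprD addrAC.
Qed.

(** The vector field is tangent to the curve: it multiplies the equation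
x^2 - h(g) by - x.  The factor g in [g_om] contributes the same multiple, so
nothing is left for Omega. *)
Lemma ad_om : ad om = 0.
Proof.
have := ad_eval_gx ('X^2 - h%:P); rewrite -g_om adM ad_g.
have -> : vfield ('X^2 - h%:P) = - 'X * ('X^2 - h%:P).
  have dh : map_poly deriv ('X^2 - h%:P) = - (h^`())%:P.
    by rewrite -polyCN expr2 map_deriv_MXaddC map_derivX mul0r add0r derivN polyCN.
  rewrite /vfield dh derivB derivXn derivC subr0 conic_polyC deriv_conic_polyC /vfield_x /=.
  transitivity (- ((2 * (2^-1)%:P%:P) * 'X^3) + 2 * 'X * lambda%:P%:P * (1 - 'X%:P ^+ 2)
    + 'X * 'X%:P * (alpha%:P%:P + 4 * lambda%:P%:P * 'X%:P) : {poly {poly k}}); first by ring.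
  rewrite half_polyC; ring.
rewrite !mulNr rmorphN rmorphM /= eval_gxX -g_om mulrA.
move/eqP; rewrite -subr_eq0 opprK addrAC addNr add0r => /eqP E.
by rewrite -[LHS]mul1r -gig -mulrA E mulr0.
Qed.

Lemma comm_om c :
  GRing.comm c g -> GRing.comm c gi -> GRing.comm c x -> GRing.comm c om.
Proof.
move=> cg cgi cx; rewrite /om -[_ *: (gi + g)]mulr_algl.
have calg a : GRing.comm c a%:A by rewrite /GRing.comm comm_alg.
by apply: commrB (calg _); apply: commrB; apply: commrM;
  [exact: commrX|exact: cgi|exact: calg|exact: commrD].
Qed.

Lemma left_idealZ (L : set A) : left_ideal L -> forall c u, L u -> L (c *: u).
Proof. by case=> _ _ LM c u Lu; rewrite -mulr_algl; apply: LM. Qed.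

Lemma left_idealB (L : set A) : left_ideal L -> forall u v, L u -> L v -> L (u - v).
Proof.
move=> LL u v Lu Lv; case: (LL) => _ LD LM.
by apply: LD => //; rewrite -mulN1r; apply: LM.
Qed.

(** Membership in a left ideal containing Omega - alpha may be tested after
simplification by x^2 = h(g). *)
Lemma eval_mem_congr (L : set A) (P Q R : {poly {poly k}}) : left_ideal L -> L om ->
  P = Q + R * ('X^2 - h%:P) -> L (eval_gx P) -> L (eval_gx Q).
Proof.
move=> LL Lom -> LP; case: (LL) => _ _ LM.
rewrite -[Q](addrK (R * ('X^2 - h%:P))) rmorphB rmorphM /= -g_om.
by apply: left_idealB => //; apply/LM/LM.
Qed.

Lemma eval_memMg (L : set A) P : left_ideal L -> L (eval_gx ('X%:P * P)) -> L (eval_gx P).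
Proof.
move=> [_ _ LM] LP; rewrite -[eval_gx P]mul1r -gig -mulrA; apply: LM.
by rewrite -eval_gxCX -rmorphM.
Qed.

(** * Ideals stable under the derivation *)

(** The condition [L_ad] holds for every two-sided ideal.  It also holds for a
left ideal containing y + x - beta g, because right multiplication by y on
k[g, x] is then, modulo L, multiplication by beta g - x. *)
Section StableIdeal.
Variable L : set A.
Hypotheses (LL : left_ideal L) (Lom : L om).
Hypothesis L_ad : forall P, L (eval_gx P) -> L (ad (eval_gx P)).

(** Take p of least degree, so that p divides every polynomial in g that belongs
to L.  From [y, p(g)] = - x g p'(g) one gets x p' in L; multiplying by x gives
h p' in L, and [y, x p'] gives h' p' + 2 h p'' in L.  A nonconstant p cannot
divide both. *)
Lemma stable_poly_ideal (p : {poly k}) : p != 0 -> L (eval_gx p%:P) -> L 1.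
Proof.
have [_ LD LM] := LL; have LB := left_idealB LL.
pose S n := `[< exists p : {poly k}, [/\ p != 0, size p = n & L (eval_gx p%:P)] >].
move=> p0 Lp; have exS : exists n, S n by exists (size p); apply/asboolP; exists p.
case: (ex_minnP exS) => _ /asboolP[{p0 Lp}p [p0 <- Lp]] pmin.
have Ldiv q : L (eval_gx q%:P) -> p %| q.
  move=> Lq; apply/negPn/negP => /negP pq.
  have := ltn_modpN0 q p0; rewrite ltnNge pmin //; apply/asboolP.
  exists (q %% p); split=> //; first by apply/negP.
  have -> : (q %% p)%:P = q%:P - (q %/ p)%:P * p%:P.
    by rewrite {2}(divp_eq q p) polyCD polyCM addrC addKr.
  by rewrite rmorphB rmorphM /=; apply: LB => //; apply: LM.
have Lx : L (eval_gx ('X * (p^`())%:P)).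
  apply: eval_memMg => //; have := LM (-1) _ (L_ad Lp).
  rewrite ad_eval_gx mulN1r -rmorphN /vfield derivC mulr0 sub0r map_polyC opprK /=.
  by rewrite mulrA [X in X * _]mulrC.
suff : size p = 1.
  move/eqP/size_poly1P => [c c0 Dp]; move: Lp; rewrite Dp eval_gxCC => Lc.
  by rewrite -[1]scale1r -(mulVf c0) -scalerA; apply: left_idealZ.
apply: (invariant_poly_constant char0 (h := h)) => //.
- exact: conic_simple_root.
- apply: Ldiv; apply: (eval_mem_congr LL Lom (P := 'X * ('X * (p^`())%:P)) (R := (p^`())%:P)) => //.
    rewrite polyCM; ring.
  by rewrite rmorphM; apply: LM.
apply: Ldiv; apply: eval_memMg => //.
(* Modulo x^2 = h(g), the element - 2 [y, x p'] is g (h' p' + 2 h p''); the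
   chosen R is the multiple of x^2 - h(g) in between. *)
have := LM ((- 2)%:A) _ (L_ad Lx); rewrite ad_eval_gx -eval_gxCC -rmorphM /= => Lf.
apply: (eval_mem_congr LL Lom (R := (p^`())%:P + 2 * 'X%:P * (p^`()^`())%:P) _ Lf).
rewrite /vfield [in map_poly _ _]mulrC map_deriv_mulX map_polyC derivM derivX derivC /=.
rewrite mulr0 addr0 mul1r -!mul_polyC /h conic_polyC polyCD !polyCM conic_polyC deriv_conic_polyC.
rewrite /vfield_x !polyCN !polyC_natr.
apply: (canRL (subrK _)).
(* The product 2 * 2^-1 is isolated, as [ring] does not simplify it. *)
transitivity ((2 * (2^-1)%:P%:P) * ('X^2 * (p^`())%:P) + 2 * 'X^2 * 'X%:P * (p^`()^`())%:P
  - 2 * lambda%:P%:P * (1 - 'X%:P ^+ 2) * (p^`())%:P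
  - ((p^`())%:P + 2 * 'X%:P * (p^`()^`())%:P)
    * ('X^2 - (2 * lambda%:P%:P + alpha%:P%:P * 'X%:P + 2 * lambda%:P%:P * 'X%:P ^+ 2))
  : {poly {poly k}}); first by ring.
rewrite half_polyC; ring.
Qed.

(** Modulo the equation of the curve an element is a(g) + b(g) x, and its norm
a^2 - b^2 h is a polynomial in g that lies in L.  The norm vanishes only if
a = b = 0. *)
Lemma stable_eval_mem P :
  L (eval_gx P) -> (exists Q, P = Q * ('X^2 - h%:P)) \/ L 1.
Proof.
have [_ LD LM] := LL.
have [Q [a [b DP]]] := quadratic_division h P.
move=> LP; have Lab : L (eval_gx (a%:P + b%:P * 'X)).
  by move: LP; apply: (eval_mem_congr LL Lom) => //; rewrite DP addrC.
have : L (eval_gx (a ^+ 2 - b ^+ 2 * h)%:P).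
  apply: (eval_mem_congr LL Lom (P := (a%:P - b%:P * 'X) * (a%:P + b%:P * 'X))
    (R := - (b ^+ 2)%:P)) => //.
    by move: (h) => h'; rewrite !(polyCB, polyCM, expr2); ring.
  by rewrite rmorphM; apply: LM.
have [/eqP|N0 LN] := eqVneq (a ^+ 2 - b ^+ 2 * h) 0; last first.
  by right; apply: stable_poly_ideal LN.
rewrite subr_eq0 => /eqP/(conic_norm_eq0 char0 lambda_neq0 disc_neq0)[a0 b0] _; left.
by exists Q; rewrite DP a0 b0 mul0r !addr0.
Qed.

End StableIdeal.

(** * The filtration by degree in y *)
Hypothesis gen : forall S : set A, S 1 -> (forall u v, S u -> S v -> S (u + v)) ->
  (forall (c : k) u, S u -> S (c *: u)) ->
  (forall u, S u -> [/\ S (g * u), S (gi * u), S (x * u) & S (y * u)]) ->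
  forall r, S r.

Lemma central_om r : om * r = r * om.
Proof.
have comm_gen c : GRing.comm c om ->
    forall u, om * u = u * om -> om * (c * u) = c * u * om.
  by move=> co u ou; rewrite mulrA -co -mulrA ou mulrA.
have gg : GRing.comm g gi by rewrite /GRing.comm ggi gig.
have xgi : GRing.comm x gi by rewrite /GRing.comm comm_gix.
have xg : GRing.comm x g by rewrite /GRing.comm comm_gx.
apply: (gen (S := [set r | om * r = r * om])) => /=.
- by rewrite mulr1 mul1r.
- by move=> u v ou ov; rewrite (mulrDr om) (mulrDl u) ou ov.
- by move=> c u ou; rewrite -scalerAr ou scalerAl.
- move=> u ou; split; apply: comm_gen => //.
  + exact/comm_om/commr_sym.
  + by apply: comm_om => //; exact/commr_sym.
  + exact: comm_om.
  + by apply/eqP; rewrite -subr_eq0; apply/eqP/ad_om.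
Qed.

(** A central element generates the same left and two-sided ideal. *)
Lemma ideal_om r : ideal_generated_by [set om] r -> exists a, r = a * om.
Proof.
apply: (smallest_sub (X := [set r | exists a, r = a * om])) => /=.
  split=> [|u v [a ->] [b ->]|a u [b ->]].
  - by exists 0; rewrite mul0r.
  - by exists (a + b); rewrite mulrDl.
  - split; first by exists (a * b); rewrite mulrA.
    by exists (b * a); rewrite -(mulrA b om) central_om mulrA.
by move=> _ ->; exists 1; rewrite mul1r.
Qed.

Section Filtration.
Variable I : set A.
Hypothesis II : two_sided_ideal I.

Let I0 : I 0. Proof. by case: II. Qed.
Let ID u v : I u -> I v -> I (u + v). Proof. by case: II => _ D _; apply: D. Qed.
Let IMl a u : I u -> I (a * u). Proof. by case: II => _ _ M /(M a)[]. Qed.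
Let IMr a u : I u -> I (u * a). Proof. by case: II => _ _ M /(M a)[]. Qed.
(** Elements of degree less than n in y, with coefficients from k[g, x] on the
left, modulo the two-sided ideal I; n = 0 gives I itself, so that the statements
below are about the quotient by I. *)
Fixpoint filt (n : nat) (r : A) : Prop :=
  if n is m.+1 then exists P s, filt m s /\ r = eval_gx P * y ^+ m + s else I r.

Lemma filtS n r : filt n r -> filt n.+1 r.
Proof. by move=> nr; exists 0, r; rewrite rmorph0 mul0r add0r. Qed.

Lemma filt_leq m n r : (m <= n)%N -> filt m r -> filt n r.
Proof. by move=> /subnK <- mr; elim: (n - m)%N => //= p; apply: filtS. Qed.

Lemma filt_ideal n r : I r -> filt n r.
Proof. exact: (filt_leq (m := 0)). Qed.

Lemma filtD n u v : filt n u -> filt n v -> filt n (u + v).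
Proof.
elim: n u v => [|n IH] u v /=; first exact: ID.
move=> [P [s [ns ->]]] [Q [t [nt ->]]]; exists (P + Q), (s + t).
by split; [exact: IH|rewrite rmorphD mulrDl addrACA].
Qed.

Lemma filt_evalM n P r : filt n r -> filt n (eval_gx P * r).
Proof.
elim: n r => [|n IH] r /=; first exact: IMl.
move=> [Q [s [ns ->]]]; exists (P * Q), (eval_gx P * s).
by split; [exact: IH|rewrite rmorphM mulrDr mulrA].
Qed.

Lemma filtZ n c r : filt n r -> filt n (c *: r).
Proof. by rewrite -mulr_algl -eval_gxCC; apply: filt_evalM. Qed.

Lemma filtB n u v : filt n u -> filt n v -> filt n (u - v).
Proof. by move=> nu nv; rewrite -scaleN1r; apply: filtD (filtZ _ nv). Qed.

Lemma filt_evalX n P : filt n.+1 (eval_gx P * y ^+ n).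
Proof. by exists P, 0; rewrite addr0; split=> //; apply: filt_ideal. Qed.

Lemma y_eval P : y * eval_gx P = eval_gx P * y + eval_gx (vfield P).
Proof. by rewrite -ad_eval_gx /ad addrCA subrr addr0. Qed.

Lemma filt_yM n r : filt n r -> filt n.+1 (y * r).
Proof.
elim: n r => [|n IH] r; first by move=> Ir; apply: filt_ideal; apply: IMl.
move=> [P [s [ns ->]]]; exists P, (eval_gx (vfield P) * y ^+ n + y * s); split.
  by apply: filtD (filt_evalX _ _) (IH _ ns).
by rewrite mulrDr mulrA y_eval mulrDl -mulrA -exprS addrA.
Qed.

Lemma filt_My n r : filt n r -> filt n.+1 (r * y).
Proof.
elim: n r => [|n IH] r; first by move=> Ir; apply: filt_ideal; apply: IMr.
move=> [P [s [ns ->]]]; exists P, (s * y); split; first exact: IH.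
by rewrite mulrDl -mulrA -exprSr.
Qed.

(** Each of the n + 1 factors y contributes [y, f] y^n to the commutator of
y^(n + 1) with f; moving [y, f] to the left costs only lower terms. *)
Lemma filt_comm_expy n Q :
  filt n (y ^+ n.+1 * eval_gx Q - eval_gx Q * y ^+ n.+1
          - n.+1%:R *: (eval_gx (vfield Q) * y ^+ n)).
Proof.
elim: n Q => [|n IH] Q.
  by rewrite expr1 expr0 mulr1 scale1r y_eval -addrA -opprD subrr; exact: I0.
set F := eval_gx (vfield Q); have IHQ := IH Q; rewrite -/F in IHQ.
have E1 : y ^+ n.+2 * eval_gx Q - eval_gx Q * y ^+ n.+2 =
    y * (y ^+ n.+1 * eval_gx Q - eval_gx Q * y ^+ n.+1) + F * y ^+ n.+1.
  rewrite mulrBr (mulrA y (y ^+ n.+1)) (mulrA y (eval_gx Q)) y_eval mulrDl.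
  by rewrite -(mulrA (eval_gx Q)) -(exprS y n.+1) opprD addrA subrK.
have E2 : y * (F * y ^+ n) = F * y ^+ n.+1 + eval_gx (vfield (vfield Q)) * y ^+ n.
  by rewrite mulrA y_eval mulrDl -(mulrA _ y) -(exprS y n).
have := filtD (filt_yM IHQ) (filtZ n.+1%:R (filt_evalX n (vfield (vfield Q)))).
rewrite E1 mulrBr -scalerAr E2 scalerDr opprD addrA subrK.
by rewrite -[n.+2]addn1 natrD scalerDl scale1r opprD addrACA subrr addr0.
Qed.

Lemma eval_gxC_comm P Q : eval_gx P * eval_gx Q = eval_gx Q * eval_gx P.
Proof. by rewrite -!rmorphM mulrC. Qed.

Lemma filt_comm_lead n P Q :
  filt n (eval_gx P * y ^+ n.+1 * eval_gx Q - eval_gx Q * (eval_gx P * y ^+ n.+1)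
          - n.+1%:R *: (eval_gx (P * vfield Q) * y ^+ n)).
Proof.
have := filt_evalM P (filt_comm_expy n Q).
by rewrite rmorphM /= !mulrBr -scalerAr !mulrA (eval_gxC_comm P Q).
Qed.

Lemma filt_comm n r Q : filt n.+1 r -> filt n (r * eval_gx Q - eval_gx Q * r).
Proof.
elim: n r => [|n IH] r [P [s [ns ->]]]; rewrite mulrDl mulrDr opprD addrACA.
  rewrite expr0 mulr1 eval_gxC_comm subrr add0r.
  by apply: filtB => //; [exact: IMr|exact: IMl].
apply: filtD (filtS (IH _ ns)).
rewrite -[X in filt _ X](subrK (n.+1%:R *: (eval_gx (P * vfield Q) * y ^+ n))).
by apply: filtD; [exact/filtS/filt_comm_lead|exact/filtZ/filt_evalX].
Qed.

Lemma gX_y j : g ^+ j * y = (y + j%:R *: x) * g ^+ j.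
Proof.
elim: j => [|j IH]; first by rewrite expr0 scale0r addr0 mul1r mulr1.
have gy : g * y = (y + x) * g by rewrite -conj_y -mulrA gig mulr1.
rewrite exprS -mulrA IH mulrA mulrDr gy -scalerAr comm_gx scalerAl -mulrDl -mulrA -exprS.
by rewrite -addrA mulrSr scalerDl scale1r [x + _]addrC exprS.
Qed.

Lemma eval_gxgX j : eval_gx ('X%:P ^+ j) = g ^+ j.
Proof. by rewrite rmorphXn /= eval_gxCX. Qed.

(** The spanning half of a Poincare-Birkhoff-Witt theorem, with negative powers of
g cleared.  A power of g moves past y at the price of a multiple of x. *)
Lemma filt_exhaust r : exists j n, filt n (g ^+ j * r).
Proof.
apply: (gen (S := [set r | exists j n, filt n (g ^+ j * r)])) => /=.
- by exists 0, 1%N, 1, 0; rewrite rmorph1 expr0 !mulr1 addr0.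
- move=> u v [i [m mu]] [j [n nv]]; exists (i + j)%N, (m + n)%N; rewrite mulrDr.
  apply: filtD; [rewrite (addnC i)|]; rewrite exprD -mulrA -eval_gxgX;
    apply: filt_evalM.
    exact: filt_leq (leq_addr _ _) mu.
  exact: filt_leq (leq_addl _ _) nv.
- by move=> c u [j [n nu]]; exists j, n; rewrite -scalerAr; apply: filtZ.
move=> u [j [n nu]]; split.
- exists j, n; have := filt_evalM 'X%:P nu.
  by rewrite eval_gxCX !mulrA -exprS -exprSr.
- by exists j.+1, n; rewrite exprSr !mulrA -(mulrA _ g) ggi mulr1.
- exists j, n; rewrite mulrA.
  have /commrX <- : GRing.comm x g by rewrite /GRing.comm comm_gx.
  by rewrite -mulrA -eval_gxX; apply: filt_evalM.
- exists j, n.+1; rewrite mulrA gX_y -mulrA mulrDl.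
  apply: filtD; first exact: filt_yM.
  by rewrite -scalerAl -eval_gxX; apply/filtS/filtZ/filt_evalM.
Qed.

End Filtration.

(** The vector field vanishes nowhere on the curve: modulo x^2 = h(g), the value
on x is - g h' / 2 and x times the value on g is - g h, and h, h' generate the
unit ideal by [conic_discriminant]. *)
Lemma vfield_unimodular :
  - (2 * h^`()%:P) * vfield 'X + 8 * lambda%:P%:P * 'X * vfield 'X%:P =
  (alpha ^+ 2 - 16 * lambda ^+ 2)%:P%:P * 'X%:P
  + (h^`()%:P - 8 * lambda%:P%:P * 'X%:P) * ('X^2 - h%:P).
Proof.
have -> : (alpha ^+ 2 - 16 * lambda ^+ 2)%:P%:P =
    alpha%:P%:P ^+ 2 - 16 * lambda%:P%:P ^+ 2 :> {poly {poly k}}.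
  by rewrite -!polyC_natr -!polyC_exp -!polyCM -!polyCB.
rewrite /vfield map_derivX map_polyC /= !derivX derivC conic_polyC deriv_conic_polyC.
rewrite /vfield_x.
transitivity ((2 * (2^-1)%:P%:P) * ('X^2 * (alpha%:P%:P + 4 * lambda%:P%:P * 'X%:P))
  - 2 * (alpha%:P%:P + 4 * lambda%:P%:P * 'X%:P) * lambda%:P%:P * (1 - 'X%:P ^+ 2)
  - 8 * lambda%:P%:P * 'X^2 * 'X%:P : {poly {poly k}}); first by rewrite polyC1; ring.
rewrite half_polyC; ring.
Qed.

(** The classical proof that a ring of differential operators is simple.  Let r
in J have degree n + 1 in y.  The commutators of r with x and g lie in J and have
smaller degree, so they lie in I by induction.  Their leading coefficients are
n + 1 times that of r times [y, x] and [y, g]; combined as in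
[vfield_unimodular] they give t in I with the leading coefficient of r up to the
factor (n + 1) (alpha^2 - 16 lambda^2) g.  Subtracting t y from that multiple of
r lowers the degree. *)
Lemma filt_two_sided_ideal (I J : set A) : two_sided_ideal I -> I om ->
  two_sided_ideal J -> I `<=` J -> ~ J 1 -> forall n r, filt I n r -> J r -> I r.
Proof.
move=> II Iom JJ IJ J1.
have [I0 ID IM] := II; have [J0 JD JM] := JJ.
have Il a u : I u -> I (a * u) by case/(IM a).
have Ir a u : I u -> I (u * a) by case/(IM a).
have Jl a u : J u -> J (a * u) by case/(JM a).
have Jr a u : J u -> J (u * a) by case/(JM a).
have leftI : left_ideal I by split.
have leftJ : left_ideal J by split.
elim=> [//|[|n] IH] r [P [s [ns Dr]]] Jr'.
  rewrite expr0 mulr1 in Dr; rewrite Dr; apply: ID => //.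
  have JP : J (eval_gx P).
    by rewrite -[eval_gx P](addrK s) -Dr; apply: (left_idealB leftJ) => //; apply: IJ.
  have J_ad Q : J (eval_gx Q) -> J (ad (eval_gx Q)).
    by move=> JQ; apply: (left_idealB leftJ) => //; [apply: Jl|apply: Jr].
  have [[Q ->]|//] := stable_eval_mem leftJ (IJ _ Iom) J_ad JP.
  by rewrite rmorphM /= -g_om; apply/Il/Il.
pose B1 := - (2 * h^`()%:P); pose B2 := 8 * lambda%:P%:P * 'X : {poly {poly k}}.
pose D := alpha ^+ 2 - 16 * lambda ^+ 2.
pose R := h^`()%:P - 8 * lambda%:P%:P * 'X%:P.
pose comm Q := r * eval_gx Q - eval_gx Q * r.
pose t := eval_gx B1 * comm 'X + eval_gx B2 * comm 'X%:P.
have Jt : J t.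
  have Jcomm Q : J (comm Q) by apply: (left_idealB leftJ); [apply: Jr|apply: Jl].
  by apply: JD; apply: Jl.
have nt : filt I n.+1 t.
  by apply: filtD => //; apply: filt_evalM => //; apply: filt_comm => //; exists P, s.
have It : I t by apply: IH.
have comm_lead Q : filt I n (comm Q - n.+1%:R *: (eval_gx (P * vfield Q) * y ^+ n)).
  have := filtD II (filt_comm_lead II n P Q) (filt_comm II Q ns).
  congr filt; rewrite /comm Dr (mulrDl _ s) (mulrDr (eval_gx Q) _ s).
  by rewrite (opprD _ (eval_gx Q * s)) [in RHS]addrACA [RHS]addrAC.
have combine (b1 b2 c1 c2 a1 a2 e p z : A) (N d : k) : b1 * a1 + b2 * a2 = d *: p + e ->
    b1 * (c1 - N *: (a1 * z)) + b2 * (c2 - N *: (a2 * z)) + N *: (e * z) =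
    b1 * c1 + b2 * c2 - (N * d) *: (p * z).
  move=> E; rewrite !mulrBr -!scalerAr !mulrA addrACA -opprD -scalerDr -mulrDl E.
  by rewrite mulrDl scalerDr opprD addrA subrK -scalerAl scalerA.
have key : eval_gx B1 * eval_gx (P * vfield 'X) + eval_gx B2 * eval_gx (P * vfield 'X%:P)
    = D *: eval_gx (P * 'X%:P) + eval_gx (P * R) * (g * om).
  rewrite -mulr_algl -eval_gxCC g_om -!rmorphM -!rmorphD; congr eval_gx.
  transitivity (P * (B1 * vfield 'X + B2 * vfield 'X%:P)); first by ring.
  rewrite vfield_unimodular -/D -/R; ring.
have t_lead : filt I n (t - (n.+1%:R * D) *: (eval_gx (P * 'X%:P) * y ^+ n)).
  have IR : I (n.+1%:R *: (eval_gx (P * R) * (g * om) * y ^+ n)).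
    by apply: (left_idealZ leftI); apply/Ir/Il/Il.
  have := filtD II (filtD II (filt_evalM II B1 (comm_lead 'X))
    (filt_evalM II B2 (comm_lead 'X%:P))) (filt_ideal n IR).
  by congr filt; apply: combine key.
have ND0 : n.+1%:R * D != 0 by rewrite mulf_neq0 ?natrS_neq0.
have Ity : I (t * y) by apply: Ir.
suff Igr : I ((n.+1%:R * D) *: (g * r)).
  rewrite -[r]mul1r -gig -mulrA -[g * r]scale1r -(mulVf ND0) -scalerA.
  by apply: Il; apply: (left_idealZ leftI).
rewrite -[_ *: _](subrK (t * y)); apply: ID => //; apply: IH; last first.
  by apply: (left_idealB leftJ) => //; [apply: (left_idealZ leftJ); apply: Jl|apply: Jr].
have -> : (n.+1%:R * D) *: (g * r) - t * y = (n.+1%:R * D) *: (g * s)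
    - (t - (n.+1%:R * D) *: (eval_gx (P * 'X%:P) * y ^+ n)) * y.
  have combine' (c : k) (p q w s' t' : A) : g * p = q ->
      c *: (g * (p * (w * y) + s')) - t' * y = c *: (g * s') - (t' - c *: (q * w)) * y.
    move=> <-; rewrite mulrDr scalerDr mulrBl opprB -scalerAl !mulrA.
    by rewrite -addrA addrCA.
  by rewrite Dr exprSr; apply: combine'; rewrite -eval_gxCX -rmorphM mulrC.
apply: filtB => //; last exact: filt_My.
by apply: filtZ => //; rewrite -eval_gxCX; apply: filt_evalM.
Qed.

Theorem om_ideal_maximal (J : set A) :
  two_sided_ideal J -> J om -> ~ J 1 -> J `<=` ideal_generated_by [set om].
Proof.
set I := ideal_generated_by [set om] => JJ Jom J1 r Jr.
have II : two_sided_ideal I := two_sided_ideal_generated _.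
have Iom : I om by move=> K [_]; apply.
have IJ : I `<=` J by apply: smallest_sub => // _ ->.
have [_ _ JM] := JJ; have [_ _ IM] := II.
have [j [n nr]] := filt_exhaust II r.
have /(IM (gi ^+ j))[+ _] : I (g ^+ j * r).
  by apply: (filt_two_sided_ideal II Iom JJ IJ J1 nr); case: (JM (g ^+ j) r Jr).
by rewrite mulrA -exprMn_comm /GRing.comm ?gig ?ggi // expr1n mul1r.
Qed.

Variable beta : k.

(** The left ideal generated by Omega - alpha and y + x - beta g is maximal:
modulo it every power of y becomes a polynomial in g and x, so that a larger left
ideal contains an element of k[g, x] that is not a multiple of x^2 - h(g). *)
Theorem om_left_ideal_maximal (L0 L : set A) : left_ideal L0 -> L0 om ->
  L0 (y + x - beta *: g) -> left_ideal L -> L0 `<=` L -> ~ L `<=` L0 -> L 1.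
Proof.
set w := y + x - beta *: g => LL0 L0om L0w LL L0L LL0'.
set I := ideal_generated_by [set om].
have II : two_sided_ideal I := two_sided_ideal_generated _.
have [L00 L0D L0M] := LL0; have [_ LD LM] := LL.
have IL0 : I `<=` L0 by move=> _ /ideal_om[a ->]; apply: L0M.
have y_w : y = w + eval_gx (beta%:P%:P * 'X%:P - 'X).
  by rewrite rmorphB rmorphM /= eval_gxCC eval_gxCX eval_gxX mulr_algl /w addrA subrK addrK.
have evalM_y P : exists Q, L0 (y * eval_gx P - eval_gx Q).
  exists (P * (beta%:P%:P * 'X%:P - 'X) + vfield P).
  rewrite y_eval (rmorphD eval_gx (P * _)) (rmorphM eval_gx P) /= opprD addrACA.
  rewrite subrr addr0 [X in _ * X - _]y_w.
  by rewrite mulrDr addrK; apply: L0M.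
have expy n : exists Q, L0 (y ^+ n - eval_gx Q).
  elim: n => [|n [Q HQ]]; first by exists 1; rewrite rmorph1 subrr.
  have [Q' HQ'] := evalM_y Q; exists Q'.
  by have := L0D _ _ (L0M y _ HQ) HQ'; rewrite mulrBr -exprS addrA subrK.
have filt_eval n r : filt I n r -> exists P, L0 (r - eval_gx P).
  elim: n r => [|n IH] r /=; first by exists 0; rewrite rmorph0 subr0; apply: IL0.
  move=> [P [s [/IH[Q LQ] ->]]]; have [Q' LQ'] := expy n; exists (P * Q' + Q).
  have := L0D _ _ (L0M (eval_gx P) _ LQ') LQ.
  by rewrite rmorphD rmorphM /= mulrBr opprD addrACA.
have [r [Lr L0r]] : exists r, L r /\ ~ L0 r.
  apply: contrapT => H; apply: LL0' => r Lr; apply: contrapT => ?.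
  by apply: H; exists r.
have [j [n /filt_eval[P L0P]]] := filt_exhaust II r.
have LP : L (eval_gx P).
  rewrite -[eval_gx P](subKr (g ^+ j * r)); apply: (left_idealB LL) => //; first exact: LM.
  exact: L0L.
have L_ad Q : L (eval_gx Q) -> L (ad (eval_gx Q)).
  move=> LQ; rewrite /ad; apply: (left_idealB LL) => //; first exact: LM.
  rewrite {1}y_w mulrDr; apply: LD; first exact/LM/L0L.
  by rewrite eval_gxC_comm; apply: LM.
have [[Q DP]|//] := stable_eval_mem LL (L0L _ L0om) L_ad LP.
case: L0r.
have : L0 (gi ^+ j * (g ^+ j * r)).
  apply/L0M; rewrite -[g ^+ j * r](subrK (eval_gx P)); apply: L0D => //.
  by rewrite DP rmorphM /= -g_om; apply/L0M/L0M.
by rewrite mulrA -exprMn_comm /GRing.comm ?gig ?ggi // expr1n mul1r.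
Qed.

End JordanAlgebra.

(** * Actions of free algebras *)
Section GeneratedAlgebraAction.
Variables (k : comNzRingType) (F : algType k) (X : Type) (gen : X -> F).
Hypothesis gen_ind : forall S : set F, S 1 ->
  (forall u v, S u -> S v -> S (u + v)) -> (forall (c : k) u, S u -> S (c *: u)) ->
  (forall s u, S u -> S (gen s * u)) -> forall r, S r.
Variables (V : lmodType k) (op : X -> V -> V) (act : F -> V -> V).
Hypothesis act1 : forall v, act 1 v = v.
Hypothesis actD : forall r s v, act (r + s) v = act r v + act s v.
Hypothesis actZ : forall c r v, act (c *: r) v = c *: act r v.
Hypothesis act_gen : forall s r v, act (gen s * r) v = op s (act r v).

(** For a fixed second factor, compatibility with products is a linear condition
that passes from r to gen s * r, so generators suffice. *)
Lemma action_mul r s v : act (r * s) v = act r (act s v).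
Proof.
apply: (gen_ind (S := fun r => act (r * s) v = act r (act s v))).
- by rewrite mul1r act1.
- by move=> u w Eu Ew; rewrite mulrDl !actD Eu Ew.
- by move=> c u Eu; rewrite -scalerAl !actZ Eu.
- by move=> t u Eu; rewrite -mulrA !act_gen Eu.
Qed.

End GeneratedAlgebraAction.

Section AlgebraAction.
Variables (k : comNzRingType) (F : algType k) (V : lmodType k) (act : F -> V -> V).
Hypothesis act1 : forall v, act 1 v = v.
Hypothesis actD : forall r s v, act (r + s) v = act r v + act s v.
Hypothesis actZ : forall c r v, act (c *: r) v = c *: act r v.
Hypothesis actM : forall r s v, act (r * s) v = act r (act s v).

Lemma action_opp r v : act (- r) v = - act r v.
Proof. by have := actZ (-1) r v; rewrite !scaleN1r. Qed.

Let actE := (actD, action_opp, actZ, actM, act1).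

Lemma action_commutator (a b c : F) (d l : k) v :
  act (b * a - a * b - (- (d *: a ^+ 2) + l *: (1 - c ^+ 2))) v =
  act b (act a v) - act a (act b v)
  - (- (d *: act a (act a v)) + l *: (v - act c (act c v))).
Proof. by rewrite !expr2 !actE. Qed.

Lemma action_casimir (a b c : F) (d e : k) v :
  act (a ^+ 2 * b - d *: (b + c) - e%:A) v =
  act a (act a (act b v)) - d *: (act b v + act c v) - e *: v.
Proof. by rewrite !expr2 !actE. Qed.

Lemma action_generator (a b c : F) (d : k) v :
  act (a + b - d *: c) v = act a v + act b v - d *: act c v.
Proof. by rewrite !actE. Qed.

End AlgebraAction.

Section FreeAlgebraAction.
Variables (k : comNzRingType) (X : choiceType).
Local Notation free := (free_algebra k X).

Lemma free_gen_mul (s : X) (u : free) :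
  free_gen k s * u = \sum_(m <- msupp u) << u@_m *g mmul (fmu s) m >>.
Proof.
rewrite /free_gen [LHS]fgmulUg.
by apply: eq_bigr => m _; rewrite mul1r.
Qed.

Lemma free_algebra_ind (S : set free) : S 1 ->
  (forall u v, S u -> S v -> S (u + v)) -> (forall (c : k) u, S u -> S (c *: u)) ->
  (forall s u, S u -> S (free_gen k s * u)) -> forall r, S r.
Proof.
move=> S1 SD SZ SM r; rewrite [r]monalgE.
have S0 : S 0 by rewrite -(scale0r 1); apply: SZ.
apply: big_ind => // m _; rewrite -[<< _ *g m >>]/(<< r@_m *g m >> : free).
have -> : << r@_m *g m >> = r@_m *: << m >> :> free.
  by apply/malgP => n; rewrite (mcoeffZ r@_m) !(mcoeffU m) mulrnAr mulr1.
apply: SZ; case: m => l; elim: l => [|s l IH].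
  by rewrite -[FMonom _]fmoneE.
have -> : << FMonom (s :: l) >> = free_gen k s * << FMonom l >> :> free.
  rewrite /free_gen [RHS]fgmulUU mulr1; congr << _ *g _ >>.
  by apply/eqP; rewrite fmP fmM fmU.
exact: SM.
Qed.

Variables (V : lmodType k) (op : X -> V -> V).
Hypothesis op_linear : forall s, linear (op s).

Definition free_act (r : free) (v : V) : V :=
  \sum_(m <- msupp r) r@_m *: foldr op v m.

Lemma free_actEw (d : {fset {fmonom X}}) r v : (msupp r `<=` d)%fset ->
  free_act r v = \sum_(m <- d) r@_m *: foldr op v m.
Proof.
move=> le; rewrite [LHS](big_fset_incl _ le) => //= m _ /mcoeff_outdom ->.
by rewrite scale0r.
Qed.

Lemma free_actD r s v : free_act (r + s) v = free_act r v + free_act s v.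
Proof.
rewrite (free_actEw v (msuppD_le r s)) (free_actEw v (fsubsetUl (msupp r) (msupp s))).
rewrite (free_actEw v (fsubsetUr (msupp r) (msupp s))) -big_split /=.
by apply: eq_bigr => m _; rewrite mcoeffD scalerDl.
Qed.

Lemma free_actZ c r v : free_act (c *: r) v = c *: free_act r v.
Proof.
rewrite (free_actEw v (msuppZ_le c r)) scaler_sumr.
by apply: eq_bigr => m _; rewrite mcoeffZ scalerA.
Qed.

Lemma free_act0 v : free_act 0 v = 0.
Proof. by rewrite /free_act msupp0 big_seq_fset0. Qed.

Lemma free_actU c m v : free_act << c *g m >> v = c *: foldr op v m.
Proof. by rewrite (free_actEw v msuppU_le) big_seq_fset1 mcoeffUU. Qed.

Lemma free_act1 v : free_act 1 v = v.
Proof. by rewrite free_actU fm1 scale1r. Qed.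

Lemma free_act_gen_mul s u v : free_act (free_gen k s * u) v = op s (free_act u v).
Proof.
pose f := GRing.isLinear.Build k V V _ (op s) (op_linear s).
pose F : {linear V -> V} := HB.pack (op s) f.
rewrite free_gen_mul -[op s]/(F : V -> V) linear_sum.
rewrite (big_morph (free_act^~ v) (fun _ _ => free_actD _ _ v) (free_act0 v)).
by apply: eq_bigr => m _; rewrite free_actU fmM fmU linearZ.
Qed.

Lemma free_act_gen s v : free_act (free_gen k s) v = op s v.
Proof. by rewrite -[free_gen k s]mulr1 free_act_gen_mul free_act1. Qed.

Lemma free_actM r s v : free_act (r * s) v = free_act r (free_act s v).
Proof.
exact: (action_mul free_algebra_ind free_act1 free_actD free_actZ free_act_gen_mul).
Qed.

Lemma free_actN r v : free_act (- r) v = - free_act r v.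
Proof. by have := free_actZ (-1) r v; rewrite !scaleN1r. Qed.

Lemma free_act_v0 r : free_act r 0 = 0.
Proof.
move: r; apply: (free_algebra_ind (S := fun r => free_act r 0 = 0)); cbv beta.
- by rewrite free_act1.
- by move=> u w Eu Ew; rewrite free_actD Eu Ew addr0.
- by move=> c u Eu; rewrite !free_actZ Eu scaler0.
- move=> t u Eu; rewrite free_act_gen_mul Eu.
  by have := op_linear t (-1) 0 0; rewrite scaler0 addr0 scaleN1r addNr.
Qed.

End FreeAlgebraAction.

(** * A nonzero module with Omega = alpha *)
Section Model.
Variables (k : fieldType) (two_neq0 : 2 != 0 :> k) (lambda alpha beta : k).
Local Notation V := (bool * int -> k^o).
Implicit Types v : V.

(** A vector v is a formal series a(g) + b(g) x, infinite in both directions: the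
coefficient of g^n is v (false, n) and that of g^n x is v (true, n).  The series
[conic_shift b] is h(g) b(g) = b(g) x^2. *)
Definition conic_shift (b : int -> k) (n : int) : k :=
  2 * lambda * b n + alpha * b (n - 1) + 2 * lambda * b (n - 1 - 1).

(** The series - g b' h - g b h' / 2, which is D(b(g) x) for the derivation D with
D(g) = - x g and D(x) = - g h' / 2, the latter being equal to
- x^2 / 2 + lambda (1 - g^2) when x^2 = h(g). *)
Definition conic_field (b : int -> k) (n : int) : k :=
  - (2 * lambda * n%:~R * b n + alpha * (n%:~R - 1) * b (n - 1)
       + 2 * lambda * (n%:~R - 2) * b (n - 1 - 1))
  - (alpha * 2^-1 * b (n - 1) + 2 * lambda * b (n - 1 - 1)).

(** g and x act by multiplication, and y acts as D + (beta g - x). *)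
Definition model_op (s : generator) (v : V) : V :=
  let a n := v (false, n) in let b n := v (true, n) in
  match s with
  | Gen_g => fun p => v (p.1, p.2 - 1)
  | Gen_ginv => fun p => v (p.1, p.2 + 1)
  | Gen_x => fun p => if p.1 then a p.2 else conic_shift b p.2
  | Gen_y => fun p =>
      if p.1 then - p.2%:~R * a p.2 + beta * b (p.2 - 1) - a p.2
      else conic_field b p.2 + beta * a (p.2 - 1) - conic_shift b p.2
  end.

Lemma model_op_linear s : linear (model_op s).
Proof.
have E c u v p : (c *: u + v : V) p = c * u p + v p by [].
move=> c u v; apply/funext => -[[] n]; rewrite E; case: s => /=;
  rewrite /conic_field /conic_shift !E; ring.
Qed.

Local Notation act := (free_act model_op).

Let actM r s v : act (r * s) v = act r (act s v).
Proof. exact: (free_actM model_op_linear). Qed.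

Let modelB u v p : (u - v : V) p = u p - v p.
Proof. by []. Qed.

Let modelZ c v p : (c *: v : V) p = c * v p.
Proof. by []. Qed.

Let modelD u v p : (u + v : V) p = u p + v p.
Proof. by []. Qed.

Let modelN v p : (- v : V) p = - v p.
Proof. by []. Qed.

Let act_gen s v : act (free_gen k s) v = model_op s v.
Proof. exact: (free_act_gen model_op_linear). Qed.

Lemma model_relator r v : U_relators lambda r -> act r v = 0.
Proof.
move=> [[[[]|]|]|] ->.
- rewrite free_actD free_actN actM !act_gen free_act1.
  apply/funext => -[c n] /=; rewrite modelB /= subrK; exact: subrr.
- rewrite free_actD free_actN actM !act_gen free_act1.
  apply/funext => -[c n] /=; rewrite modelB /= addrK; exact: subrr.
- rewrite free_actD free_actN !actM !act_gen.
  apply/funext => -[c n] /=; rewrite modelB; case: c => /=;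
    rewrite /conic_shift !(subrK (1 : int)); exact: subrr.
- rewrite free_actD free_actN free_actD !actM !act_gen.
  apply/funext => -[c n] /=; rewrite modelB modelD; case: c => /=;
    rewrite /conic_field /conic_shift !(subrK (1 : int)) ?intrB ?mulr1z -[RHS]/0; ring.
- have -> := action_commutator (free_act1 model_op) (free_actD model_op)
    (free_actZ model_op) actM
    (free_gen k Gen_x) (free_gen k Gen_y) (free_gen k Gen_g) 2^-1 lambda v.
  rewrite !act_gen.
  apply/funext => -[c n] /=; rewrite !(modelD, modelN, modelZ); case: c => /=;
    rewrite /conic_shift /conic_field ?intrB ?mulr1z -[RHS]/0; field; exact: two_neq0.
Qed.

Lemma model_relations r v : ideal_generated_by (U_relators lambda) r -> act r v = 0.
Proof.
move=> Ir; move: r Ir v.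
apply: (smallest_sub (X := [set r | forall v, act r v = 0])) => /=.
  split=> [v|r s r0 s0 v|a r r0].
  - exact: free_act0.
  - by rewrite free_actD r0 s0 addr0.
  - by split=> v; rewrite actM r0 // (free_act_v0 model_op_linear).
by move=> r /= Rr v; apply: model_relator.
Qed.

Definition model_act (r : U lambda) (v : V) : V := act (repr r) v.

Lemma model_act_pi (u : free_algebra k generator) v :
  model_act (\pi_(U lambda) u) v = act u v.
Proof.
rewrite /model_act; set w := repr _.
have : ideal_generated_by (U_relators lambda) (u - w).
  by apply/asboolP/(quot_module_eqP (relation_ideal (U_relators lambda))); rewrite reprK.
move/model_relations => /(_ v); rewrite free_actD free_actN => /eqP.
by rewrite subr_eq0 => /eqP.
Qed.

Lemma model_actM r s v : model_act (r * s) v = model_act r (model_act s v).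
Proof. by rewrite -[r]reprK -[s]reprK -quot_algebra_piM !model_act_pi actM. Qed.

Lemma model_actD r s v : model_act (r + s) v = model_act r v + model_act s v.
Proof. by rewrite -[r]reprK -[s]reprK -quot_module_piD !model_act_pi free_actD. Qed.

Lemma model_actZ c r v : model_act (c *: r) v = c *: model_act r v.
Proof. by rewrite -[r]reprK -quot_module_piZ !model_act_pi free_actZ. Qed.

Lemma model_act1 v : model_act 1 v = v.
Proof. by rewrite -quot_algebra_pi1 model_act_pi free_act1. Qed.

Lemma model_act_gen s v : model_act (U_gen lambda s) v = model_op s v.
Proof. by rewrite model_act_pi act_gen. Qed.

(** The series 1. *)
Definition model_vector : V := fun p => ((~~ p.1) && (p.2 == 0))%:R.

Lemma model_Omega v : model_act (Omega lambda - alpha%:A) v = 0.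
Proof.
have -> := action_casimir model_act1 model_actD model_actZ model_actM
  (U_gen lambda Gen_x) (U_gen lambda Gen_ginv) (U_gen lambda Gen_g) (2 * lambda) alpha v.
rewrite !model_act_gen; apply/funext => -[c n] /=.
rewrite !(modelD, modelN, modelZ); case: c => /=;
  rewrite /conic_shift !addrK ?(subrK (1 : int)) -[RHS]/0; ring.
Qed.

Lemma model_vector_y :
  model_act (U_gen lambda Gen_y + U_gen lambda Gen_x - beta *: U_gen lambda Gen_g)
    model_vector = 0.
Proof.
have -> := action_generator model_actD model_actZ
  (U_gen lambda Gen_y) (U_gen lambda Gen_x) (U_gen lambda Gen_g) beta model_vector.
rewrite !model_act_gen; apply/funext => -[c n] /=.
rewrite !(modelD, modelN, modelZ); case: c => /=;
  rewrite /conic_field /conic_shift /model_vector /= -[RHS]/0; last by ring.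
by case: (n =P 0) => [->|_]; rewrite /= ?mulr0z; ring.
Qed.

Lemma model_act_v0 r : model_act r 0 = 0.
Proof. exact: (free_act_v0 model_op_linear). Qed.

(** Every element of the left ideal kills the series 1, but 1 does not. *)
Lemma oner_notin_left_ideal2 :
  ~ left_ideal2 (Omega lambda - alpha%:A)
      (U_gen lambda Gen_y + U_gen lambda Gen_x - beta *: U_gen lambda Gen_g) 1.
Proof.
move=> /asboolP[u [w E]]; have := model_act1 model_vector.
rewrite E model_actD !model_actM model_Omega model_vector_y !model_act_v0 addr0.
move/(congr1 (fun v : V => v (false, 0))); rewrite /model_vector /= => /esym/eqP.
by rewrite -[(0 : V) _]/0 oner_eq0.
Qed.

End Model.

(** * The presentation of U(lambda) *)
Lemma morphism_commutator (k : comNzRingType) (F A : algType k) (p : F -> A)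
    (pD : forall u v, p (u + v) = p u + p v)
    (pZ : forall (c : k) u, p (c *: u) = c *: p u)
    (pM : forall u v, p (u * v) = p u * p v) (p1 : p 1 = 1) (a b c : F) (d l : k) :
  p (b * a - a * b - (- (d *: a ^+ 2) + l *: (1 - c ^+ 2))) =
  p b * p a - p a * p b - (- (d *: p a ^+ 2) + l *: (1 - p c ^+ 2)).
Proof.
have pN u : p (- u) = - p u by have := pZ (-1) u; rewrite !scaleN1r.
by rewrite !expr2 !(pD, pN, pZ, pM, p1).
Qed.

Section Presentation.
Variables (k : fieldType) (lambda : k).
Local Notation U := (U lambda).
Local Notation g := (U_gen lambda Gen_g).
Local Notation gi := (U_gen lambda Gen_ginv).
Local Notation x := (U_gen lambda Gen_x).
Local Notation y := (U_gen lambda Gen_y).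

Let pi (u : free_algebra k generator) : U := \pi_U u.

Let piD u v : pi (u + v) = pi u + pi v.
Proof. exact: quot_module_piD. Qed.

Let piZ a u : pi (a *: u) = a *: pi u.
Proof. exact: quot_module_piZ. Qed.

Let piM u v : pi (u * v) = pi u * pi v.
Proof. exact: quot_algebra_piM. Qed.

Lemma U_relation u v : U_relators lambda (u - v) -> pi u = pi v.
Proof.
move=> uv; apply/(quot_module_eqP (relation_ideal (U_relators lambda))).
by apply/asboolP => I [_]; apply.
Qed.

Lemma U_mulgV : g * gi = 1.
Proof. by rewrite -piM; apply: U_relation; do 4 left. Qed.

Lemma U_mulVg : gi * g = 1.
Proof. by rewrite -piM; apply: U_relation; do 3 left; right. Qed.

Lemma U_conj_x : g * x * gi = x.
Proof. by rewrite -!piM; apply: U_relation; do 2 left; right. Qed.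

Lemma U_conj_y : g * y * gi = y + x.
Proof. by rewrite -!piM -piD; apply: U_relation; left; right. Qed.

Lemma U_commutator_yx :
  y * x - x * y = - (2^-1 *: x ^+ 2) + lambda *: (1 - g ^+ 2).
Proof.
apply: subr0_eq.
have <- := morphism_commutator piD piZ piM (erefl (pi 1))
  (free_gen k Gen_x) (free_gen k Gen_y) (free_gen k Gen_g) 2^-1 lambda.
have <- : pi 0 = 0 by have := piZ 0 0; rewrite !scale0r.
by apply: U_relation; rewrite subr0; right.
Qed.

Lemma U_generated (S : set U) : S 1 -> (forall u v, S u -> S v -> S (u + v)) ->
  (forall (c : k) u, S u -> S (c *: u)) ->
  (forall u, S u -> [/\ S (g * u), S (gi * u), S (x * u) & S (y * u)]) ->
  forall r, S r.
Proof.
move=> S1 SD SZ SM r; rewrite -[r]reprK; move: (repr r).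
apply: (free_algebra_ind (S := fun u => S (pi u))) => // [u v Su Sv|c u Su|s u Su].
- by rewrite piD; apply: SD.
- by rewrite piZ; apply: SZ.
- by rewrite piM; case: s; case: (SM _ Su).
Qed.

End Presentation.

(** * Cyclic modules *)
Section CyclicModule.
Variables (R : nzRingType) (V : lmodType R) (v : V).
Hypothesis cyclic_v : forall m : V, exists r : R, m = r *: v.

Definition vector_annihilator : set R := [set r | r *: v = 0].

Lemma left_ideal_vector_annihilator : left_ideal vector_annihilator.
Proof.
split=> [|a b|a b]; rewrite /vector_annihilator /=; first by rewrite scale0r.
  by rewrite scalerDl => -> ->; rewrite addr0.
by rewrite -scalerA => ->; rewrite scaler0.
Qed.

(** A submodule N corresponds to the left ideal of all r with r v in N, so a
cyclic module is simple when its generator has a maximal annihilator. *)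
Lemma cyclic_simple_module : v != 0 ->
  (forall L : set R, left_ideal L -> vector_annihilator `<=` L ->
     ~ L `<=` vector_annihilator -> L 1) -> simple_module V.
Proof.
move=> v0 max_ann; split; first by exists v.
move=> N [/set_mem N0 Nlin]; have [N_triv|N_nontriv] := pselect (N `<=` [set 0]).
  by left; apply/seteqP; split=> // _ ->.
have ND m n : N m -> N n -> N (m + n).
  by move=> Nm Nn; rewrite -[m]scale1r; apply/set_mem/Nlin; apply/mem_set.
have NM a m : N m -> N (a *: m).
  by move=> Nm; rewrite -[_ *: _]addr0; apply/set_mem/Nlin; apply/mem_set.
have N1 : N (1 *: v).
  apply: (max_ann [set r | N (r *: v)]) => [|r /= -> //|LL]; last first.
    apply: N_nontriv => m; have [r ->] := cyclic_v m; exact: LL.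
  split=> /= [|a b|a b]; first by rewrite scale0r.
    by rewrite scalerDl; apply: ND.
  by rewrite -scalerA; apply: NM.
right; apply/seteqP; split=> // m _; have [r ->] := cyclic_v m.
by apply: NM; rewrite -[v]scale1r.
Qed.

Lemma two_sided_ideal_annihilator : two_sided_ideal (annihilator V).
Proof.
split=> [m|a b a0 b0 m|a b b0]; first by rewrite scale0r.
  by rewrite scalerDl a0 b0 addr0.
by split=> m; rewrite -scalerA ?b0 // scaler0.
Qed.

Lemma central_annihilator c :
  (forall r, c * r = r * c) -> vector_annihilator c -> annihilator V c.
Proof.
by move=> cC cv m; have [r ->] := cyclic_v m; rewrite scalerA cC -scalerA cv scaler0.
Qed.

End CyclicModule.

Section QuotientByLeftIdeal.
Variables (R : nzRingType) (a b : R).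
Local Notation Q := (quot_module (left_ideal2 a b)).

Definition quot_vector : Q := \pi_Q (1 : R^o).

Lemma quot_vector_pi (r : R) : r *: quot_vector = \pi_Q (r : R^o).
Proof. by rewrite /quot_vector -quot_module_piZ /GRing.scale /= mulr1. Qed.

Lemma quot_vector_cyclic (m : Q) : exists r : R, m = r *: quot_vector.
Proof. by exists (repr m); rewrite quot_vector_pi reprK. Qed.

Lemma quot_vector_annihilator : vector_annihilator quot_vector = left_ideal2 a b.
Proof.
apply/funext => r; apply/propext; rewrite /vector_annihilator /= quot_vector_pi.
have <- : \pi_Q (0 : R^o) = 0 by rewrite -quot_vector_pi scale0r.
by split=> [/(quot_module_eqP (left_ideal2 a b))|?];
  [|apply/(quot_module_eqP (left_ideal2 a b))]; rewrite subr0.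
Qed.

End QuotientByLeftIdeal.

Theorem proposition4p9 (k : closedFieldType) (char0 : [pchar k] =i pred0)
    (lambda : k) (lambda_neq0 : lambda != 0) (alpha beta : k)
    (alpha_neq : alpha != 4 * lambda) (alpha_neqN : alpha != - (4 * lambda)) :
  simple_module (M lambda alpha beta) /\
  annihilator (M lambda alpha beta)
    = ideal_generated_by [set Omega lambda - alpha%:A].
Proof.
have disc_neq0 : alpha ^+ 2 - 16 * lambda ^+ 2 != 0.
  have -> : alpha ^+ 2 - 16 * lambda ^+ 2 = (alpha - 4 * lambda) * (alpha - - (4 * lambda)).
    by ring.
  by rewrite mulf_neq0 // subr_eq0.
set om := Omega lambda - alpha%:A.
set w := U_gen lambda Gen_y + U_gen lambda Gen_x - beta *: U_gen lambda Gen_g.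
pose v : M lambda alpha beta := quot_vector om w.
have cyclic_v (m : M lambda alpha beta) : exists r, m = r *: v.
  exact: quot_vector_cyclic.
have ann_v : vector_annihilator v = left_ideal2 om w by exact: quot_vector_annihilator.
have LLv := left_ideal_vector_annihilator v.
have v_om : vector_annihilator v om.
  by rewrite ann_v; apply/asboolP; exists 1, 0; rewrite mul0r mul1r addr0.
have v_w : vector_annihilator v w.
  by rewrite ann_v; apply/asboolP; exists 0, 1; rewrite mul0r mul1r add0r.
have v1 : ~ vector_annihilator v 1.
  by rewrite ann_v; apply: oner_notin_left_ideal2; exact: (natrS_neq0 char0 1).
have v_neq0 : v != 0.
  by apply/eqP => v0; apply: v1; rewrite /vector_annihilator /= v0 scaler0.
have ggi := U_mulgV lambda; have gig := U_mulVg lambda.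
have conj_x := U_conj_x lambda; have conj_y := U_conj_y lambda.
have comm_yx := U_commutator_yx lambda; have gen := @U_generated _ lambda.
split.
  apply: (cyclic_simple_module cyclic_v v_neq0) => L LL.
  exact: (om_left_ideal_maximal char0 lambda_neq0 disc_neq0 ggi gig conj_x conj_y
    comm_yx gen LLv v_om v_w LL).
have ann_ideal := two_sided_ideal_annihilator (M lambda alpha beta).
have ann_om : annihilator (M lambda alpha beta) om.
  apply: (central_annihilator cyclic_v) v_om => r.
  exact: (central_om char0 alpha ggi gig conj_x conj_y comm_yx gen).
apply/seteqP; split; last by apply: smallest_sub => // _ ->.
apply: (om_ideal_maximal char0 lambda_neq0 disc_neq0 ggi gig conj_x conj_y
  comm_yx gen) => //.
by move=> ann1; apply: v1; exact: ann1.
Qed.
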